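(* There is an absolute constant $c>0$ such that for all positive integers $r$ and $m$ and every integer $n \ge c\cdot 6^{rm}$ the following holds: if the points of $D(n)=\{0,1\}^n\times\{0,1\}^n$ are colored arbitrarily with $r$ colors, then there is a monochromatic binary tree with $m$ levels in $D(n)$.
   Context: Write $[n]=\{1,\dots,n\}$. For $I\subseteq[n]$, $\overline{I}=[n]\setminus I$ and $C=(c_j)_{j\in\overline I}\in\{0,1\}^{\overline I}$, the line $L(I,C)\subseteq D(n)$ is the set of all pairs $((x_1,\dots,x_n),(y_1,\dots,y_n))$ with $y_i=1-x_i$ for $i\in I$ and $x_j=y_j=c_j$ for $j\in\overline I$; it has $2^{|I|}$ points, and every point of $D(n)$ lies on exactly one line. A binary tree with $m$ levels in $D(n)$ is a family of points $P_v\in D(n)$ indexed by the binary words $v$ of length $0,1,\dots,m$ (the point $P_\emptyset$ is the root, and the points $P_v$ with $|v|=k$ form level $k$) such that: for every word $v$ of length less than $m$, if $P_v=(X,Y)$ then $P_{v0}=(X,Y_1)$ and $P_{v1}=(X_1,Y)$ for some $Y_1\in\{0,1\}^n$ and some $X_1\in\{0,1\}^n$ with $X_1\neq X$; and for each $k$ with $0\le k\le m$, all the $2^k$ points of level $k$ lie on a common line. (For $m=1$ this is a corner: three points $(X,Y),(X',Y),(X,Y')$ with $(X,Y')$ and $(X',Y)$ on a common line.) Monochromatic means all points of the family receive the same color. *)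

(* Defs.v *)
From mathcomp Require Import all_boot all_order all_algebra.

Set Implicit Arguments.
Unset Strict Implicit.
Unset Printing Implicit Defensive.

(* The set D(n) of pairs of 0-1 vectors of length n; coordinates are numbered
   0, ..., n - 1 and the bits 0 and 1 are false and true. *)
Notation cube n := {ffun 'I_n -> bool}.
Notation D n := (cube n * cube n)%type.

Definition line (n : nat) (I : {set 'I_n})
    (C : {ffun {j : 'I_n | j \notin I} -> bool}) : {set D n} :=
  [set p : D n |
    [forall i in I, p.2 i == ~~ p.1 i] &&
    [forall j : {j : 'I_n | j \notin I},
       (p.1 (val j) == C j) && (p.2 (val j) == C j)]].

(* A family indexed by the binary words of length at most m is given as a
   function on all words; its values on longer words are never inspected. *)
Definition binary_tree (n m : nat) (P : seq bool -> D n) : Prop :=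
  (forall v : seq bool, size v < m ->
     exists X1 Y1 : cube n,
       [/\ X1 != (P v).1,
           P (rcons v false) = ((P v).1, Y1) &
           P (rcons v true) = (X1, (P v).2)]) /\
  (forall k : nat, k <= m ->
     exists (I : {set 'I_n}) (C : {ffun {j : 'I_n | j \notin I} -> bool}),
       forall v : seq bool, size v = k -> P v \in line C).

Definition monochromatic (n r m : nat) (col : D n -> 'I_r)
    (P : seq bool -> D n) : Prop :=
  exists a : 'I_r, forall v : seq bool, size v <= m -> col (P v) = a.

(* Main.v *)
(* A point on a line with free coordinates I is determined by its first vector
   x, so it is encoded as (x, flip I x).  In this encoding a binary tree is a
   root x together with sets I_0 < I_1 < ... < I_m: the points of level k are
   (y, flip I_k y), where y is x flipped along some of the increments
   I_i \ I_(i-1), i <= k.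

   Such sets are built from the leaves down.  Start with all coordinates free
   and the most popular color class A.  By a second moment argument on the
   translates of the powerset of a block of about log(1/density) free
   coordinates, some nonempty J in that block satisfies x, flip J x \in A for
   a density^2/2 proportion of the x; freeze J, pass to the most popular color
   on the smaller line, and repeat r * m times.  Some color is selected m + 1
   times, and the corresponding sets of free coordinates form a tree.  Since
   log(1/density) roughly doubles at each step, about 2^(rm) (2r + 1)
   coordinates are enough. *)
Require Import Defs.
From mathcomp Require Import all_boot all_order all_algebra reals.
From mathcomp Require Import zify.
Import Order.TTheory GRing.Theory Num.Theory.
Local Open Scope ring_scope.

Section BinaryTrees.
Local Open Scope nat_scope.
Set Implicit Arguments.
Unset Strict Implicit.
Unset Printing Implicit Defensive.

(** * Pigeonhole and finite dependent choice *)

Lemma popular_color (T : finType) (A : {set T}) r (f : T -> 'I_r) :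
  0 < r -> exists a, #|A| <= r * #|[set x in A | f x == a]|.
Proof.
move=> r_gt0; pose g a := #|[set x in A | f x == a]|.
case: (arg_maxnP (P := xpredT) g (i0 := Ordinal r_gt0) isT) => a _ amax.
exists a; rewrite -sum1_card (partition_big f xpredT) //=.
apply: (@leq_trans (\sum_(b < r) g a)); last by rewrite sum_nat_const card_ord.
apply: leq_sum => b _; apply: leq_trans (amax b isT).
by rewrite sum1dep_card leq_eqVlt /g; apply/orP/or_introl/eqP/eq_card => x; rewrite !inE.
Qed.

Lemma exists_subset_card (T : finType) (A : {set T}) k :
  k <= #|A| -> exists2 B : {set T}, B \subset A & #|B| = k.
Proof.
case/card_geqP=> s [s_uniq s_size sA]; exists [set x in s].
  by apply/subsetP=> x; rewrite inE; apply: sA.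
by rewrite cardsE (card_uniqP s_uniq).
Qed.

Lemma dependent_sequence (T : Type) (P : nat -> T -> Prop)
    (R : T -> T -> Prop) x0 K :
    P 0 x0 ->
    (forall k x, k < K -> P k x -> exists y, P k.+1 y /\ R x y) ->
  exists f : nat -> T, [/\ forall k, k <= K -> P k (f k) &
                           forall k, k < K -> R (f k) (f k.+1)].
Proof.
move=> P0 step; elim: K step => [_|K IHK step].
  by exists (fun=> x0); split=> // k; rewrite leqn0 => /eqP->.
have [|f [Pf Rf]] := IHK; first by move=> k x /ltnW /step; apply.
have [y [Py Ry]] := step K (f K) (ltnSn K) (Pf K (leqnn K)).
exists (fun k => if k <= K then f k else y); split=> k.
  by case: (leqP k K) => [/Pf // | ltKk lekK]; have -> : k = K.+1 by lia.
move=> /[!ltnS] lekK; rewrite lekK; case: ltnP => [/Rf // | leKk].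
by have -> : k = K by lia.
Qed.

(** * Flips of the cube and the second moment argument *)

Section Flip.
Variable n : nat.
Implicit Types (x z : cube n) (J S B : {set 'I_n}) (A : {set cube n}).

Definition flip J x : cube n := [ffun i => x i (+) (i \in J)].

Lemma flipK J : involutive (flip J).
Proof. by move=> x; apply/ffunP=> i; rewrite !ffunE -addbA addbb addbF. Qed.

Lemma flip_neq J x : J != set0 -> flip J x != x.
Proof.
case/set0Pn=> i Ji; apply: contraNneq (negbT (addbb true)) => /ffunP/(_ i).
by rewrite ffunE Ji; case: (x i).
Qed.

Lemma flip_diff J1 J2 x : J1 \subset J2 -> flip J2 (flip (J2 :\: J1) x) = flip J1 x.
Proof.
move=> /subsetP sJ; apply/ffunP=> i; rewrite !ffunE inE.
have:= sJ i; case: (i \in J1) => [->//|_]; first by rewrite addbF.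
by rewrite -addbA addbb addbF.
Qed.

Lemma flip_diff_trans J1 J2 J3 x : J1 \subset J2 -> J2 \subset J3 ->
  flip (J3 :\: J2) (flip (J2 :\: J1) x) = flip (J3 :\: J1) x.
Proof.
move=> /subsetP s12 /subsetP s23; apply/ffunP=> i; rewrite !ffunE !inE -addbA.
have/implyP := s12 i; have/implyP := s23 i.
by case: (x i) (i \in J1) (i \in J2) (i \in J3) => [] [] [] [].
Qed.

Definition stable_part A J := [set x in A | flip J x \in A].

(** The substitution [z = flip S1 x] leaves only the symmetric difference of [S1] and [S2]. *)
Lemma card_two_flips A S1 S2 :
  #|[set z | (flip S1 z \in A) && (flip S2 z \in A)]|
    = #|stable_part A (S1 :\: S2 :|: S2 :\: S1)|.
Proof.
rewrite -(card_preimset _ (inv_inj (flipK S1))); apply: eq_card => z.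
rewrite !inE flipK; congr (_ && (_ \in A)); apply/ffunP=> i; rewrite !ffunE !inE.
by case: (z i) (i \in S1) (i \in S2) => [] [] [].
Qed.

Lemma popular_difference A B d :
    2 ^ n <= #|A| * 2 ^ d -> #|B| = d.+1 ->
  exists J, [/\ J \subset B, J != set0 &
                2 ^ n <= #|stable_part A J| * 2 ^ (d.*2.+1)].
Proof.
move=> Adense cardB; pose D := 2 ^ d; pose PB := powerset B.
(* The [2 * D] subsets of [B] are just enough for the number of [S] in [PB] with [flip S z \in A] to
   average at least 2 over [z]. *)
have cardPB : #|PB| = 2 * D by rewrite card_powerset cardB expnS.
have D_gt0 : 0 < D by rewrite expn_gt0.
have N_gt0 : 0 < 2 ^ n by rewrite expn_gt0.
pose g S1 S2 := #|[set z | (flip S1 z \in A) && (flip S2 z \in A)]|.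
pose a z := \sum_(S in PB) (flip S z \in A).
have gE S1 S2 : \sum_z (flip S1 z \in A) * (flip S2 z \in A) = g S1 S2.
  rewrite /g -sum1dep_card [RHS]big_mkcond.
  by apply: eq_bigr => z _; rewrite mulnb; case: (_ && _).
have gdiag S : g S S = #|A|.
  rewrite /g -(card_preimset A (inv_inj (flipK S))).
  by apply: eq_card => z; rewrite !inE andbb.
have sum_a : \sum_z a z = 2 * D * #|A|.
  rewrite exchange_big /= -cardPB -sum_nat_const; apply: eq_bigr => S _.
  by rewrite -(gdiag S) -gE; apply: eq_bigr => z _; case: (_ \in A).
have sum_a2 : \sum_z a z * a z = \sum_(S1 in PB) \sum_(S2 in PB) g S1 S2.
  under eq_bigr => z _ do rewrite big_distrlr /=.
  rewrite exchange_big; apply: eq_bigr => S1 _ /=.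
  by rewrite exchange_big; apply: eq_bigr => S2 _; apply: gE.
(* (a z - 2)^2 >= 0, where 2 is a lower bound on the mean of a *)
have moment : 4 * (2 * D * #|A|) <= \sum_z a z * a z + 4 * 2 ^ n.
  have -> : 4 * 2 ^ n = \sum_(z : cube n) 4.
    by rewrite sum_nat_const card_ffun card_bool card_ord mulnC.
  rewrite -sum_a big_distrr -big_split /=; apply: leq_sum => z _.
  by case: (a z) => [|[|k]]; nia.
have [//|none] := boolP [exists J : {set 'I_n}, [&& J \subset B, J != set0 &
    2 ^ n <= #|stable_part A J| * 2 ^ (d.*2.+1)]].
  by case/existsP=> J /and3P[]; exists J.
(* If no [J] works, every off-diagonal pair count is small. *)
have gsmall S1 S2 : S1 \in PB -> S2 \in PB -> S2 != S1 ->
    g S1 S2 * (2 * (D * D)) <= 2 ^ n.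
  rewrite !inE => s1B s2B neqS; rewrite /g card_two_flips.
  have J_neq0 : S1 :\: S2 :|: S2 :\: S1 != set0.
    by apply: contraNneq neqS => /eqP; rewrite setU_eq0 !setD_eq0 eqEsubset andbC.
  have J_sub : S1 :\: S2 :|: S2 :\: S1 \subset B.
    by rewrite subUset !(subset_trans (subsetDl _ _)).
  have := existsPn none (S1 :\: S2 :|: S2 :\: S1).
  rewrite J_neq0 J_sub /= -ltnNge => /ltnW.
  by rewrite -addnn expnS expnD.
have row_small S1 : S1 \in PB ->
    (\sum_(S2 in PB) g S1 S2) * (2 * (D * D))
      <= #|A| * (2 * (D * D)) + (2 * D).-1 * 2 ^ n.
  move=> S1B; rewrite (bigD1 S1) //= gdiag mulnDl leq_add2l big_distrl /=.
  have -> : (2 * D).-1 = #|PB :\ S1| by rewrite -cardPB (cardsD1 S1) S1B.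
  rewrite -sum_nat_const; under [X in _ <= X]eq_bigl => S do rewrite in_setD1 andbC.
  by apply: leq_sum => S2 /andP[]; apply: gsmall.
have total : (\sum_z a z * a z) * (2 * (D * D))
    <= 2 * D * (#|A| * (2 * (D * D)) + (2 * D).-1 * 2 ^ n).
  by rewrite sum_a2 big_distrl -[X in X * (_ + _)]cardPB -sum_nat_const; apply: leq_sum.
exfalso; move: moment total Adense N_gt0 D_gt0; rewrite -/D.
move: (\sum_z _) #|A| (2 ^ n) (D) => M2 cA N E; clear=> moment total dense N_gt0 E_gt0.
have {}total : M2 * E <= 2 * cA * (E * E) + (2 * E).-1 * N.
  by rewrite -(leq_pmul2l E_gt0) -(leq_pmul2l (isT : 0 < 2)); move: total; move: (2 * E).-1 => p; nia.
(* With [N <= cA * E] this yields [6 * E * N <= (6 * E - 1) * N], which is absurd; the [- 1] comes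
   from the diagonal, omitted in [(2 * E).-1]. *)
have : 8 * E * cA * E <= 2 * cA * (E * E) + (2 * E).-1 * N + 4 * N * E by nia.
by have : N * E <= cA * E * E; nia.
Qed.

(** Choosing a color costs a factor [r <= 2 ^ r], hence [r] more in the exponent. *)
Lemma dense_color r (f : cube n -> 'I_r) A d : 0 < r -> 2 ^ n <= #|A| * 2 ^ d ->
  exists (a : 'I_r) A', [/\ A' \subset A, 2 ^ n <= #|A'| * 2 ^ (d + r) &
                            forall x, x \in A' -> f x = a].
Proof.
move=> r_gt0 Adense; have [a leA] := popular_color A f r_gt0.
exists a, [set x in A | f x == a]; split; first by apply/subsetP=> x /setIdP[].
  apply: leq_trans Adense _; rewrite addnC expnD mulnA leq_mul2r; apply/orP; right.
  by apply: leq_trans leA _; rewrite mulnC leq_mul // ltnW // ltn_expl.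
by move=> x /setIdP[_ /eqP].
Qed.

End Flip.

(** * Growth of the codensity and of the number of frozen coordinates *)

(* After k steps the current color class has at least 2 ^ (n - codensity r k)
   elements and at most consumed r k coordinates have been frozen. *)
Fixpoint codensity r k := if k is j.+1 then (codensity r j).*2.+1 + r else r.

Fixpoint consumed r k :=
  if k is j.+1 then consumed r j + (codensity r j).+1 else 0.

Lemma consumed_homo r : {homo consumed r : j k / j <= k}.
Proof. by apply: homo_leq => [//|? ? ? /leq_trans|k]; [apply | apply: leq_addr]. Qed.

(** Adding [r.+1] turns the recurrence into plain doubling. *)
Lemma codensityE r k : codensity r k + r.+1 = r.*2.+1 * 2 ^ k.
Proof. by elim: k => /= [|k IHk]; rewrite ?expnS; lia. Qed.

Lemma consumed_le r k : consumed r k <= r.*2.+1 * 2 ^ k.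
Proof.
elim: k => //= k IHk; have := codensityE r k; rewrite expnS; lia.
Qed.

(** The factor [r.*2.+1] is at most [3 ^ r], so it is absorbed in [3 ^ (r * m)] and the constant can
    be 1. *)
Lemma consumed_le_exp6 r m : 0 < r -> 0 < m -> consumed r (r * m) <= 6 ^ (r * m).
Proof.
move=> r_gt0 m_gt0; apply: leq_trans (consumed_le r (r * m)) _.
rewrite -[6]/(3 * 2) expnMn leq_mul2r; apply/orP; right.
apply: (@leq_trans (3 ^ r)); last by rewrite leq_exp2l // leq_pmulr.
by elim: r {m_gt0} r_gt0 => // -[//|r] IHr _; rewrite expnS; have := IHr isT; lia.
Qed.

(** * The chain of free sets and color classes *)

Section Trees.
Variables (n r : nat) (col : D n -> 'I_r).
Hypothesis r_gt0 : 0 < r.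

Lemma color_chain K : consumed r K <= n ->
  exists (I : nat -> {set 'I_n}) (A : nat -> {set cube n}) (c : nat -> 'I_r),
    [/\ forall k, k < K -> I k.+1 \proper I k,
        forall k, k < K -> A k.+1 \subset stable_part (A k) (I k :\: I k.+1),
        forall k x, k <= K -> x \in A k -> col (x, flip (I k) x) = c k &
        A K != set0].
Proof.
move=> leKn.
pose P k (s : {set 'I_n} * {set cube n} * 'I_r) :=
  [/\ n <= #|s.1.1| + consumed r k, 2 ^ n <= #|s.1.2| * 2 ^ codensity r k &
      forall x, x \in s.1.2 -> col (x, flip s.1.1 x) = s.2].
pose Q (s t : {set 'I_n} * {set cube n} * 'I_r) :=
  t.1.1 \proper s.1.1 /\ t.1.2 \subset stable_part s.1.2 (s.1.1 :\: t.1.1).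
have [|a0 [A0 [_ A0dense A0col]]] :=
    @dense_color n r (fun x => col (x, flip setT x)) setT 0 r_gt0.
  by rewrite cardsT card_ffun card_bool card_ord muln1.
have [||f [Pf Qf]] := @dependent_sequence _ P Q (setT, A0, a0) K.
- by split; rewrite //= cardsT card_ord addn0.
- move=> k [[I A] a] ltkK [/= leI Adense _].
  (* The block is still free because [consumed r k.+1 <= n]. *)
  have [|B sBI cardB] := @exists_subset_card _ I (codensity r k).+1.
    by have := leq_trans (consumed_homo r ltkK) leKn; rewrite /=; lia.
  have [J [sJB J_neq0 Jdense]] := popular_difference Adense cardB.
  have [a' [A' [sA' A'dense A'col]]] :=
    dense_color (fun x => col (x, flip (I :\: J) x)) r_gt0 Jdense.
  have sJI := subset_trans sJB sBI.
  have defJ : I :\: (I :\: J) = J by rewrite setDDr setDv set0U; apply/setIidPr.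
  exists (I :\: J, A', a'); split; last first.
    split; rewrite /= ?defJ // properEneq subsetDl andbT.
    by apply: contraNneq J_neq0 => eqI; rewrite -defJ eqI setDv.
  split=> //=; have := subset_leq_card sJB; rewrite cardB cardsD.
  by rewrite (setIidPr sJI); clear -leI; move: #|I| #|J| leI; lia.
exists (fun k => (f k).1.1), (fun k => (f k).1.2), (fun k => (f k).2); split.
- by move=> k /Qf[].
- by move=> k /Qf[].
- by move=> k x /Pf[_ _]; apply.
have [_ + _] := Pf K (leqnn K); apply: contraTneq => ->.
by rewrite cards0 -ltnNge expn_gt0.
Qed.

Section Chain.
Variables (K : nat) (I : nat -> {set 'I_n}) (A : nat -> {set cube n}).
Hypothesis I_proper : forall k, k < K -> I k.+1 \proper I k.
Hypothesis A_stable :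
  forall k, k < K -> A k.+1 \subset stable_part (A k) (I k :\: I k.+1).

Lemma chain_subset j k : j <= k <= K -> I k \subset I j.
Proof.
elim: k => [|k IHk]; first by rewrite leqn0 => /andP[/eqP->].
rewrite leq_eqVlt ltnS => /andP[/orP[/eqP-> //|lejk] ltkK].
by apply: subset_trans (IHk _); rewrite ?proper_sub ?I_proper // lejk ltnW.
Qed.

Lemma chain_proper j k : j < k <= K -> I k \proper I j.
Proof.
move=> /andP[ltjk lekK]; apply: sub_proper_trans (I_proper (leq_trans ltjk lekK)).
by rewrite chain_subset ?ltjk.
Qed.

(** Steps of one color need not be adjacent; flips by successive increments compose to a single
    flip. *)
Lemma chain_stable j k : j <= k <= K ->
  A k \subset stable_part (A j) (I j :\: I k).
Proof.
elim: k => [|k IHk] /andP[+ lekK].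
  rewrite leqn0 => /eqP->; apply/subsetP=> x Ax; rewrite inE Ax setDv.
  by rewrite (_ : flip _ _ = x) //; apply/ffunP=> i; rewrite ffunE inE addbF.
rewrite leq_eqVlt ltnS => /orP[/eqP-> |lejk].
  apply/subsetP=> x Ax; rewrite inE Ax setDv.
  by rewrite (_ : flip _ _ = x) //; apply/ffunP=> i; rewrite ffunE inE addbF.
have lekK' := ltnW lekK.
have /subsetP sA : A k \subset stable_part (A j) (I j :\: I k).
  by apply: IHk; rewrite lejk.
apply/subsetP=> x /(subsetP (A_stable lekK)).
rewrite !inE => /andP[/sA/[!inE]/andP[-> _] /sA/[!inE]/andP[_]].
by rewrite flip_diff_trans ?chain_subset ?leqnSn ?lejk.
Qed.

End Chain.

(** * Extraction of the tree *)

Theorem monochromatic_tree m : consumed r (r * m) <= n ->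
  exists P : seq bool -> D n, binary_tree m P /\ monochromatic m col P.
Proof.
set K := r * m => leKn.
have [I [A [c [I_proper A_stable A_col /set0Pn[x0 Ax0]]]]] := color_chain leKn.
(* There are [r * m + 1] steps, so some color occurs more than [m] times. *)
have [a le_a] := popular_color [set: 'I_K.+1] (fun i => c i) r_gt0.
pose ks := [seq k <- iota 0 K.+1 | c k == a].
have ks_size : m < size ks.
  have -> : size ks = #|[set i in [set: 'I_K.+1] | c i == a]|.
    rewrite -sum1dep_card size_filter -sum1_count -[iota _ _]/(index_iota 0 K.+1).
    by rewrite big_mkord; apply: eq_bigl => i; rewrite inE.
  by rewrite cardsT card_ord in le_a; rewrite -(ltn_pmul2l r_gt0).
have ks_sorted : sorted ltn ks by rewrite sorted_filter ?iota_ltn_sorted //; apply: ltn_trans.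
(* Level t of the tree lives on the line of step e t; steps go from the leaves
   to the root, so e is decreasing. *)
pose e t := nth 0 ks (m - t).
have ks_mem t : e t \in ks by rewrite mem_nth ?(leq_ltn_trans (leq_subr t m)).
have e_le t : e t <= K by have := ks_mem t; rewrite mem_filter mem_iota => /and3P[].
have e_col t : c (e t) = a.
  by apply/eqP; have := ks_mem t; rewrite mem_filter => /andP[].
have e_lt t : t < m -> e t.+1 < e t.
  by move=> ltm; rewrite (sorted_ltn_nth ltn_trans) ?inE //; lia.
pose J t := I (e t.+1) :\: I (e t).
(* The first vector of the point indexed by v is X (rev v). *)
pose fix X w := if w is b :: u then (if b then flip (J (size u)) (X u) else X u) else x0.
have X_rcons v b :
    X (rev (rcons v b)) = if b then flip (J (size v)) (X (rev v)) else X (rev v).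
  by rewrite rev_rcons /= size_rev.
have I_sub t : t < m -> I (e t) \subset I (e t.+1).
  by move=> ltm; apply: (chain_subset I_proper); rewrite e_le ltnW ?e_lt.
have X_in v : size v <= m -> X (rev v) \in A (e (size v)).
  elim/last_ind: v => [_|v b IHv].
    have /subsetP/(_ x0 Ax0) : A K \subset stable_part (A (e 0)) (I (e 0) :\: I K).
      by apply: (chain_stable I_proper A_stable); rewrite e_le leqnn.
    by rewrite inE => /andP[].
  rewrite size_rcons X_rcons => ltm.
  have /subsetP sA : A (e (size v)) \subset stable_part (A (e (size v).+1)) (J (size v)).
    by apply: (chain_stable I_proper A_stable); rewrite e_le ltnW ?e_lt.
  have /[!inE]/andP[] := sA _ (IHv (ltnW ltm)).
  by case: b.
(* Flips up to a level touch only coordinates free there, so all its points share the fixed part of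
   [x0]. *)
have X_out v i : size v <= m -> i \notin I (e (size v)) -> X (rev v) i = x0 i.
  elim/last_ind: v => [//|v b IHv]; rewrite size_rcons X_rcons => ltm iI.
  have iI' : i \notin I (e (size v)) by apply: contra iI; exact: (subsetP (I_sub _ ltm)).
  case: b; rewrite ?ffunE ?inE ?(negbTE iI) ?andbF ?addbF; exact: IHv (ltnW ltm) iI'.
exists (fun v => (X (rev v), flip (I (e (size v))) (X (rev v)))); split; last first.
  by exists a => v lem; rewrite A_col ?X_in ?e_le.
split=> [v ltm | k lem].
  (* Enlarging the free set changes only the second vector; flipping the first by the increment as
     well undoes that change. *)
  exists (flip (J (size v)) (X (rev v))), (flip (I (e (size v).+1)) (X (rev v))).
  rewrite !X_rcons !size_rcons flip_diff ?I_sub //; split=> //; apply: flip_neq.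
  have /properP[_ [i Ii I'i]] : I (e (size v)) \proper I (e (size v).+1).
    by apply: (chain_proper I_proper); rewrite e_le e_lt.
  by apply/set0Pn; exists i; rewrite inE I'i.
exists (I (e k)), [ffun j => x0 (val j)] => v sz_v; rewrite -sz_v in lem *.
rewrite inE; apply/andP; split.
  by apply/forall_inP=> i Ii; rewrite ffunE Ii addbT.
apply/forallP=> -[j Ij] /=; rewrite !ffunE (negbTE Ij) addbF X_out //=.
by rewrite eqxx.
Qed.

End Trees.
End BinaryTrees.

Theorem theorem1 (R : realType) :
  exists c : R, 0 < c /\
    forall r m n : nat, (0 < r)%N -> (0 < m)%N ->
      c * 6%:R ^+ (r * m) <= n%:R ->
      forall col : D n -> 'I_r,
        exists P : seq bool -> D n,
          binary_tree m P /\ monochromatic m col P.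
Proof.
exists 1; split=> // r m n r_gt0 m_gt0; rewrite mul1r -natrX ler_nat => le_n col.
apply: monochromatic_tree => //; exact: leq_trans (consumed_le_exp6 r_gt0 m_gt0) le_n.
Qed.
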